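(* Let $U\subset\mathbb{R}^n$ be open with $n\ge2$ and let $F=\sqrt[m]{A}$ be an $m$-th root Finsler metric on $U$. Suppose that $F$ is of isotropic mean Berwald curvature, i.e. there is a scalar function $c=c(x)$ on $U$ such that $E_{ij}=\frac{n+1}{2}\,c\,F^{-1}h_{ij}$ for all $i,j$. Then $F$ is a weakly Berwald metric, i.e. $E_{ij}=0$ for all $i,j$.
   Context: Summation over repeated indices is understood; $(x^i,y^i)$ are the standard coordinates on $TU=U\times\mathbb{R}^n$, and identities involving $y$ hold for all $x\in U$, $y\neq 0$. A Finsler metric on $U$ is a function $F:TU\to[0,\infty)$ that is $C^\infty$ for $y\ne0$, satisfies $F(x,\lambda y)=\lambda F(x,y)$ for $\lambda>0$, and for which $g_{ij}=\frac12\frac{\partial^2F^2}{\partial y^i\partial y^j}$ is positive definite for $y\neq0$; $(g^{ij})$ is its inverse. An $m$-th root Finsler metric ($m\ge 2$ an integer) is a Finsler metric of the form $F=\sqrt[m]{A}$ with $A=a_{i_1\dots i_m}(x)y^{i_1}\cdots y^{i_m}$, where the functions $a_{i_1\dots i_m}$ are smooth on $U$ and symmetric in all indices. Standing assumption: the matrix $A_{ij}=\frac{\partial^2A}{\partial y^i\partial y^j}$ is positive definite for $y\neq 0$. The spray coefficients of $F$ are $G^i=\frac14g^{il}\Big\{\frac{\partial^2F^2}{\partial x^k\partial y^l}y^k-\frac{\partial F^2}{\partial x^l}\Big\}$. The Berwald curvature is $B^i_{\ jkl}=\frac{\partial^3G^i}{\partial y^j\partial y^k\partial y^l}$, and the mean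 Berwald curvature ($E$-curvature) is $E_{jk}=\frac12B^s_{\ jks}$ (sum over $s$). The angular metric is $h_{ij}=g_{ij}-F^{-2}\,g_{ip}y^p\,g_{jq}y^q$. *)

(* Defs.v *)
From HB Require Import structures.
From mathcomp Require Import all_boot all_order all_algebra all_fingroup.
From mathcomp Require Import all_classical all_reals all_analysis.

Set Implicit Arguments.
Unset Strict Implicit.
Unset Printing Implicit Defensive.

Import Order.TTheory GRing.Theory Num.Theory.
Import numFieldNormedType.Exports.

Local Open Scope classical_set_scope.
Local Open Scope ring_scope.

(* Functions on U or TU = U x R^n are represented by total functions on
   R^n or R^n x R^n. Only their values over the open set U matter: every
   hypothesis below is restricted to U, and derivatives are local. *)

Section Smoothness.
Context {R : realType} {V : normedModType R}.

(* C^k regularity on an open set; V is always R^n or R^n x R^n below, where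
   continuity of all directional derivatives is continuity of the (Frechet)
   derivative. *)
Fixpoint Ck_on (k : nat) (D : set V) (f : V -> R) : Prop :=
  if k is k'.+1 then
    (forall p, D p -> differentiable f p) /\
    (forall v : V, Ck_on k' D (fun p => 'D_v f p))
  else forall p, D p -> {for p, continuous f}.

Definition smooth_on (D : set V) (f : V -> R) : Prop :=
  forall k, Ck_on k D f.

End Smoothness.

Definition posdefmx (R : realType) (n : nat) (M : 'M[R]_n) : Prop :=
  forall v : 'rV[R]_n, v != 0 -> 0 < (v *m M *m v^T) 0 0.

Section Finsler.
Context {R : realType} {n : nat}.

Local Notation pt := ('rV[R]_n * 'rV[R]_n)%type.
Implicit Types (U : set 'rV[R]_n) (F f : pt -> R) (p : pt).

Definition slit_tangent U : set pt := [set p | U p.1 /\ p.2 != 0].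

Definition dx (i : 'I_n) f : pt -> R :=
  fun p => 'D_((delta_mx 0 i, 0) : pt) f p.
Definition dy (i : 'I_n) f : pt -> R :=
  fun p => 'D_((0, delta_mx 0 i) : pt) f p.

Definition hessian_y f p : 'M[R]_n := \matrix_(i, j) dy i (dy j f) p.

Definition fsqr F : pt -> R := fun p => F p ^+ 2.

Definition fund_tensor F p : 'M[R]_n := 2^-1 *: hessian_y (fsqr F) p.

Record finsler_metric U F : Prop := FinslerMetric {
  finsler_ge0 : forall x y, U x -> 0 <= F (x, y);
  finsler_smooth : smooth_on (slit_tangent U) F;
  finsler_homogeneous : forall x y (l : R),
    U x -> 0 < l -> F (x, l *: y) = l * F (x, y);
  finsler_posdef : forall p, slit_tangent U p -> posdefmx (fund_tensor F p)
}.

(* A(x, y) = a_{i_1 ... i_m}(x) y^{i_1} ... y^{i_m}, the multi-index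
   (i_1, ..., i_m) being a function from 'I_m to 'I_n *)
Definition root_form (m : nat) (a : {ffun 'I_m -> 'I_n} -> 'rV[R]_n -> R) :
    pt -> R :=
  fun p => \sum_(I : {ffun 'I_m -> 'I_n})
             a I p.1 * \prod_(k < m) p.2 0 (I k).

(* powR is a genuine m-th root only on nonnegative numbers, hence the field
   root_form_ge0; it is implied by F ^ m = A and F >= 0. *)
Record mth_root_finsler_metric U (m : nat)
    (a : {ffun 'I_m -> 'I_n} -> 'rV[R]_n -> R) F : Prop :=
  MthRootFinslerMetric {
  root_finsler : finsler_metric U F;
  root_coef_smooth : forall I, smooth_on U (a I);
  root_coef_sym : forall (s : 'S_m) (I : {ffun 'I_m -> 'I_n}) x,
    U x -> a [ffun k => I (s k)] x = a I x;
  root_form_ge0 : forall x y, U x -> 0 <= root_form a (x, y);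
  root_finslerE : forall x y,
    U x -> F (x, y) = root_form a (x, y) `^ (m%:R^-1)
}.

Definition spray F (i : 'I_n) : pt -> R :=
  fun p => 4^-1 * \sum_(l < n) invmx (fund_tensor F p) i l *
    (\sum_(k < n) dx k (dy l (fsqr F)) p * p.2 0 k - dx l (fsqr F) p).

Definition berwald F (i j k l : 'I_n) : pt -> R :=
  dy j (dy k (dy l (spray F i))).

Definition mean_berwald F (j k : 'I_n) : pt -> R :=
  fun p => 2^-1 * \sum_(s < n) berwald F s j k s p.

Definition angular_metric F (i j : 'I_n) : pt -> R :=
  fun p => fund_tensor F p i j -
    (F p ^+ 2)^-1 * (\sum_(q < n) fund_tensor F p i q * p.2 0 q) *
                    (\sum_(q < n) fund_tensor F p j q * p.2 0 q).

Definition isotropic_mean_berwald U F : Prop :=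
  exists c : 'rV[R]_n -> R, forall p, slit_tangent U p ->
    forall i j : 'I_n,
      mean_berwald F i j p =
      (n.+1)%:R / 2 * c p.1 * (F p)^-1 * angular_metric F i j p.

Definition weakly_berwald U F : Prop :=
  forall p, slit_tangent U p -> forall i j : 'I_n, mean_berwald F i j p = 0.

End Finsler.

(* Main.v *)
Require Import Defs.
From mathcomp Require Import all_boot all_order all_algebra.
From mathcomp Require Import all_classical all_reals all_analysis.
Import numFieldNormedType.Exports.
Import Order.TTheory GRing.Theory Num.Theory.
Local Open Scope classical_set_scope.
Local Open Scope ring_scope.

(** The theorem is a parity argument in the fibre variable y.

    The form A is homogeneous of degree m in y, hence
    A(x, -y) = (-1)^m A(x, y); both values are nonnegative, so they are equal
    whatever the parity of m. Thus F is reversible: F(x, -y) = F(x, y).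

    Each derivative in y reverses the parity in y, each derivative in x keeps
    it. For a reversible F, the tensor g_ij and the angular metric h_ij are
    therefore even; the spray coefficients G^i are even, because the odd
    derivatives d^2 F^2 / dx^k dy^l are contracted with y^k; and E_jk, which
    sums third y-derivatives of G^i, is odd. In
    E_ij = (n+1)/2 c(x) F^-1 h_ij the left side is odd and the right side is
    even, as c depends on x alone. Hence E_ij = 0.

    Parity is propagated through iterated derivatives formally. The
    directional derivative is a total operation, and a diverging limit of real
    functions has the value 0; so it commutes with signs (derive_oppf,
    derive_oppv) and with the reflection y |-> -y (derive_reflect_y) at every
    point, whether or not the difference quotient converges there. *)

(** * Directional derivatives and signs *)

(** Divergent limits are covered: g and - g diverge together, and the default
    value of the limit is then 0, which is its own opposite. *)
Lemma lim_oppr (R : realType) (g : R -> R) :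
  lim ((fun h => - g h) @ 0^') = - lim (g @ 0^').
Proof.
have [cg|ncg] := pselect (cvg (g @ 0^')).
  by apply: cvg_lim => //; have := @cvgN _ _ _ _ _ _ _ cg; apply.
rewrite [in RHS]dvgP // oppr0; apply: dvgP => cNg; apply: ncg.
move/cvgN: cNg => /cvgP.
by have -> : - (fun h => - g h) = g by apply/funext => h; exact: opprK.
Qed.

Lemma derive_oppf (R : realType) (V : normedModType R) (f : V -> R) (p v : V) :
  'D_v (fun q => - f q) p = - 'D_v f p.
Proof.
rewrite /derive -lim_oppr; congr lim; f_equal.
by apply/funext => h /=; rewrite -opprD scalerN.
Qed.

Lemma dnbhs0N (R : realType) : (-%R : R -> R) @ 0^' = 0^'.
Proof.
apply/funext => A.
have nE : (fun x : R => x != 0 -> A (- x)) = (fun x => - x != 0 -> A (- x)).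
  by apply/funext => x; rewrite oppr_eq0.
transitivity (nbhs (0 : R) (fun x => x != 0 -> A (- x))); first by [].
rewrite nE; transitivity (((-%R : R -> R) @ (0 : R)) (fun x => x != 0 -> A x)).
  by [].
by rewrite -nbhsN oppr0.
Qed.

(** Substituting - h for the increment h turns the quotient along - v into
    the opposite of the quotient along v. *)
Lemma derive_oppv (R : realType) (V : normedModType R) (f : V -> R) (p v : V) :
  'D_(- v) f p = - 'D_v f p.
Proof.
have -> : 'D_(- v) f p =
    lim ((fun h => - (h^-1 *: ((f \o shift p) (h *: v) - f p)))
           @ ((-%R : R -> R) @ 0^')).
  rewrite /derive -fmap_comp; congr lim; f_equal.
  by apply/funext => h /=; rewrite scalerN scaleNr invrN scaleNr opprK.
by rewrite dnbhs0N lim_oppr.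
Qed.

(** * Parity in the fibre variable *)

Section Reflection.
Context {R : realType} {n : nat}.
Local Notation pt := ('rV[R]_n * 'rV[R]_n)%type.
Implicit Types (U : set 'rV[R]_n) (f g F : pt -> R) (p v : pt) (b c : bool).

Definition reflect_y p : pt := (p.1, - p.2).

Lemma derive_reflect_y f p v :
  'D_(reflect_y v) f (reflect_y p) = 'D_v (f \o reflect_y) p.
Proof.
rewrite /derive; congr lim; f_equal; apply/funext => h /=.
have -> // : h *: reflect_y v + reflect_y p = reflect_y (h *: v + p).
by apply: injective_projections => //=; rewrite scalerN opprD.
Qed.

(** The boolean b is the parity bit: true for functions odd in y, false for
    even ones. Only points over U are constrained, since a Finsler metric is
    only specified there. *)
Definition y_parity U b f :=
  forall p, U p.1 -> f (reflect_y p) = (-1) ^+ b * f p.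

(** Derivatives in x leave the fibre, so the parity relation is needed on a
    full neighbourhood; this is where U has to be open. *)
Lemma near_y_parity {U b f p} : open U -> U p.1 -> y_parity U b f ->
  \near p, (f \o reflect_y) p = (-1) ^+ b * f p.
Proof.
move=> oU Up fb; have : \forall x \near p.1, U x by exact: open_nbhs_nbhs.
move/(cvg_fst (F := nbhs p.1) (G := nbhs p.2)) => Uq.
by apply: (@filterS _ (nbhs p) _ (fun q => U q.1)) => // q; exact: fb.
Qed.

Lemma derive_y_parity {U b f p} v : open U -> U p.1 -> y_parity U b f ->
  'D_(reflect_y v) f (reflect_y p) = (-1) ^+ b * 'D_v f p.
Proof.
move=> oU Up fb; rewrite derive_reflect_y.
rewrite (near_eq_derive v (near_y_parity oU Up fb)).
case: b {fb}; last by under eq_fun do rewrite mul1r; rewrite mul1r.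
by under eq_fun do rewrite mulN1r; rewrite mulN1r derive_oppf.
Qed.

(** A horizontal direction is fixed by the reflection. *)
Lemma y_parity_dx {U b f} i : open U -> y_parity U b f -> y_parity U b (dx i f).
Proof.
move=> oU fb p Up; rewrite /dx -(derive_y_parity _ oU Up fb).
by rewrite /reflect_y /= oppr0.
Qed.

(** A vertical direction is reversed by the reflection. *)
Lemma y_parity_dy {U b f} i :
  open U -> y_parity U b f -> y_parity U (~~ b) (dy i f).
Proof.
move=> oU fb p Up; rewrite signrN mulNr /dy -(derive_y_parity _ oU Up fb).
rewrite -derive_oppv; congr ('D_ _ f _).
by rewrite /reflect_y /= -oppr0; congr pair; rewrite ?opprK ?oppr0.
Qed.

Lemma y_parity_coord U i : y_parity U true (fun p => p.2 0 i).
Proof. by move=> p _; rewrite /= mxE mulN1r. Qed.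

Lemma y_parityM {U b c f g} : y_parity U b f -> y_parity U c g ->
  y_parity U (b (+) c) (fun p => f p * g p).
Proof. by move=> fb gc p Up; rewrite fb // gc // signr_addb mulrACA. Qed.

Lemma y_parity_sum U b (I : finType) (f : I -> pt -> R) :
  (forall i, y_parity U b (f i)) -> y_parity U b (fun p => \sum_i f i p).
Proof.
by move=> fb p Up; rewrite mulr_sumr; apply: eq_bigr => i _; exact: fb.
Qed.

Lemma y_parityB {U b f g} : y_parity U b f -> y_parity U b g ->
  y_parity U b (fun p => f p - g p).
Proof. by move=> fb gb p Up; rewrite fb // gb // mulrBr. Qed.

Lemma y_parity_cst U (k : R) : y_parity U false (fun=> k).
Proof. by move=> p _; rewrite mul1r. Qed.

(** * Curvature of reversible metrics *)

Section ReversibleMetric.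
Context {U : set 'rV[R]_n} {F : pt -> R}.
Context (oU : open U) (Feven : y_parity U false F).

Lemma fsqr_even : y_parity U false (fsqr F).
Proof. exact: y_parityM Feven Feven. Qed.

Lemma fund_tensor_even p : U p.1 ->
  fund_tensor F (reflect_y p) = fund_tensor F p.
Proof.
move=> Up; rewrite /fund_tensor; suff -> :
  hessian_y (fsqr F) (reflect_y p) = hessian_y (fsqr F) p by [].
apply/matrixP => i j; rewrite [LHS]mxE [RHS]mxE.
by rewrite (y_parity_dy i oU (y_parity_dy j oU fsqr_even)) // mul1r.
Qed.

(** In the sum over k the odd factors dx k (dy l F^2) and y^k compensate each
    other. *)
Lemma spray_even i : y_parity U false (spray F i).
Proof.
apply: (y_parityM (b := false) (c := false)); first exact: y_parity_cst.
apply: y_parity_sum => l; apply: (y_parityM (b := false) (c := false)).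
  by move=> p Up; rewrite fund_tensor_even // mul1r.
apply: y_parityB; last exact: y_parity_dx oU fsqr_even.
apply: y_parity_sum => k.
exact: (y_parityM (y_parity_dx k oU (y_parity_dy l oU fsqr_even))
                  (y_parity_coord U k)).
Qed.

(** Three y-derivatives of the even spray. *)
Lemma mean_berwald_odd i j : y_parity U true (mean_berwald F i j).
Proof.
apply: (y_parityM (b := false) (c := true)); first exact: y_parity_cst.
apply: y_parity_sum => s.
exact: y_parity_dy oU (y_parity_dy _ oU (y_parity_dy _ oU (spray_even s))).
Qed.

Lemma angular_metric_even i j : y_parity U false (angular_metric F i j).
Proof.
have gy_odd k :
    y_parity U true (fun p => \sum_(q < n) fund_tensor F p k q * p.2 0 q).
  apply: y_parity_sum => q.
  apply: (y_parityM (b := false) (c := true)); last exact: y_parity_coord.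
  by move=> p Up; rewrite fund_tensor_even // mul1r.
apply: y_parityB; first by move=> p Up; rewrite fund_tensor_even // mul1r.
apply: (y_parityM (b := true) (c := true)); last exact: gy_odd.
apply: (y_parityM (b := false) (c := true)); last exact: gy_odd.
by move=> p Up; rewrite Feven // !mul1r.
Qed.

(** Isotropy makes E the product of a function of x with the even tensor
    F^-1 h, so E takes the same values at y and - y; being odd, it vanishes. *)
Lemma reversible_isotropic_weakly_berwald :
  isotropic_mean_berwald U F -> weakly_berwald U F.
Proof.
move=> [c Ec] p [Up y0] i j.
have ErE : mean_berwald F i j (reflect_y p) = mean_berwald F i j p.
  rewrite !Ec //; last by split=> //=; rewrite oppr_eq0.
  by rewrite Feven // angular_metric_even // !mul1r.
have := mean_berwald_odd i j p Up; rewrite ErE mulN1r => /eqP.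
by rewrite eq_sym eqNr => /eqP.
Qed.

End ReversibleMetric.

(** * Reversibility of m-th root metrics *)

Lemma root_form_reflect_y m (a : {ffun 'I_m -> 'I_n} -> 'rV[R]_n -> R) p :
  root_form a (reflect_y p) = (-1) ^+ m * root_form a p.
Proof.
rewrite /root_form mulr_sumr; apply: eq_bigr => I _.
rewrite mulrCA; congr (_ * _) => /=.
under eq_bigr do rewrite mxE -mulN1r.
by rewrite big_split /= prodr_const card_ord.
Qed.

(** A(x, y) and A(x, -y) are nonnegative and have the same absolute value, so
    no distinction between even and odd m arises. *)
Lemma mth_root_finsler_metric_even {U m}
    {a : {ffun 'I_m -> 'I_n} -> 'rV[R]_n -> R} {F} :
  mth_root_finsler_metric U a F -> y_parity U false F.
Proof.
move=> hF [x y] Ux; rewrite mul1r !(root_finslerE hF) //; congr (_ `^ _).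
rewrite -[LHS]ger0_norm ?(root_form_ge0 hF) //.
rewrite -[RHS]ger0_norm ?(root_form_ge0 hF) //.
by rewrite (@root_form_reflect_y m a (x, y)) normrM normrX normrN1 expr1n mul1r.
Qed.

End Reflection.

Theorem theorem1p3 (R : realType) (n m : nat) (hn : (2 <= n)%N)
  (hm : (2 <= m)%N) (U : set 'rV[R]_n) (hU : open U)
  (a : {ffun 'I_m -> 'I_n} -> 'rV[R]_n -> R)
  (F : 'rV[R]_n * 'rV[R]_n -> R)
  (hF : mth_root_finsler_metric U a F)
  (hA : forall p, slit_tangent U p -> posdefmx (hessian_y (root_form a) p))
  (hE : isotropic_mean_berwald U F) :
  weakly_berwald U F.
Proof.
exact: reversible_isotropic_weakly_berwald hU
  (mth_root_finsler_metric_even hF) hE.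
Qed.
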